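(* Let $n \geq 1$, let $\mathcal{Z}_n$ be the zig-zag poset on $n$ elements and let $\mathcal{O}(\mathcal{Z}_n) \subset \mathbb{R}^n$ be its order polytope. Then the numerator $h^*_{\mathcal{O}(\mathcal{Z}_n)}(t)$ of the Ehrhart series of $\mathcal{O}(\mathcal{Z}_n)$ is $$h^*_{\mathcal{O}(\mathcal{Z}_n)}(t) = \sum_{\sigma \in A_n} t^{\mathrm{swap}(\sigma)},$$ where $A_n$ is the set of all alternating permutations of $\{1,\dots,n\}$.
   Context: The zig-zag poset $\mathcal{Z}_n$ on ground set $\{z_1,\dots,z_n\}$ is the poset with exactly the cover relations $z_1 < z_2 > z_3 < z_4 > \cdots$ (i.e. $z_{2i-1}<z_{2i}$ and $z_{2i}>z_{2i+1}$ whenever the indices lie in $\{1,\dots,n\}$). Its order polytope $\mathcal{O}(\mathcal{Z}_n)$ is the set of all $(x_1,\dots,x_n)\in\mathbb{R}^n$ with $0\le x_i\le 1$ for all $i$ and $x_i\le x_j$ whenever $z_i<z_j$ in $\mathcal{Z}_n$; it is an $n$-dimensional polytope with integer vertices. For a polytope $P\subset\mathbb{R}^n$ of dimension $d$ with integer vertices, let $i_P(m)=\#(\mathbb{Z}^n\cap mP)$ for $m \geq 0$, where $mP=\{m\mathbf{v} : \mathbf{v}\in P\}$. The Ehrhart series is $\mathrm{Ehr}_P(t)=\sum_{m\ge 0} i_P(m)t^m$, and it has the form $\mathrm{Ehr}_P(t)=h^*_P(t)/(1-t)^{d+1}$ with $h^*_P(t)$ a polynomial; $h^*_P(t)$ is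 called the numerator of the Ehrhart series (the $h^*$-polynomial). For $P=\mathcal{O}(\mathcal{Z}_n)$ one has $d=n$. An alternating permutation on $n$ letters is a permutation $\sigma$ of $\{1,\dots,n\}$ with $\sigma(1)<\sigma(2)>\sigma(3)<\sigma(4)>\cdots$ (i.e. $\sigma(2i-1)<\sigma(2i)$ and $\sigma(2i)>\sigma(2i+1)$ whenever the indices lie in $\{1,\dots,n\}$). For an alternating permutation $\sigma$, $\mathrm{swap}(\sigma)$ is the number of integers $i$ with $1\le i<n$ such that $\sigma^{-1}(i)<\sigma^{-1}(i+1)-1$. *)

(* Defs.v *)
From HB Require Import structures.
From mathcomp Require Import all_boot all_order all_algebra all_fingroup.
From mathcomp Require Import finmap.
From mathcomp Require Import boolp classical_sets cardinality reals.
Set Implicit Arguments.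
Unset Strict Implicit.
Unset Printing Implicit Defensive.
Import Order.TTheory GRing.Theory Num.Theory.
Local Open Scope classical_set_scope.
Local Open Scope ring_scope.

(* Indices are 0-based throughout: z_{k+1} is the ordinal of value k, so the
   elements with odd subscript (the minimal ones) are the even ordinals.
   Likewise a permutation of {1, ..., n} is an element of 'S_n. *)

Definition zigzag_cover (n : nat) : rel 'I_n :=
  fun i j => [&& ~~ odd i, odd j & (j == i.+1 :> nat) || (i == j.+1 :> nat)].

(* An alias of 'I_n, so as not to interfere with its usual total order. *)
Definition zigzag (n : nat) : Type := 'I_n.
HB.instance Definition _ n := Finite.on (zigzag n).

Definition zigzag_le (n : nat) : rel (zigzag n) := connect (@zigzag_cover n).

Lemma zigzag_leE n (i j : zigzag n) :
  zigzag_le i j = (i == j) || zigzag_cover i j.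
Proof.
apply/idP/idP => [/connectP[[|k [|l p]] /=]|/orP[/eqP->|]].
- by move=> _ ->; rewrite eqxx.
- by rewrite andbT => ik ->; rewrite ik orbT.
- by case/and3P=> /and3P[_ ok _] /and3P[]; rewrite ok.
- exact: connect0.
- exact: connect1.
Qed.

Lemma zigzag_le_refl n : reflexive (@zigzag_le n).
Proof. by move=> i; apply: connect0. Qed.

Lemma zigzag_le_anti n : antisymmetric (@zigzag_le n).
Proof.
move=> i j /andP[]; rewrite !zigzag_leE.
case/orP=> [/eqP //|/and3P[_ oj _]] /orP[/eqP //|/and3P[]].
by rewrite oj.
Qed.

Lemma zigzag_le_trans n : transitive (@zigzag_le n).
Proof. by move=> j i k; apply: connect_trans. Qed.

Fact zigzag_display : Order.disp_t. Proof. exact: (Order.Disp tt tt). Qed.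

HB.instance Definition _ n := Order.Le_isPOrder.Build zigzag_display (zigzag n)
  (@zigzag_le_refl n) (@zigzag_le_anti n) (@zigzag_le_trans n).

Definition zigzag_lt (n : nat) : rel 'I_n :=
  fun i j => ((i : zigzag n) < (j : zigzag n))%O.

(* [lt] is the strict order of a poset with ground set 'I_n. *)
Definition order_polytope (R : realType) (n : nat) (lt : rel 'I_n) :
    set 'rV[R]_n :=
  [set x | (forall i, 0 <= x 0 i <= 1) /\
           (forall i j, lt i j -> x 0 i <= x 0 j)].
Arguments order_polytope R {n} lt.

Definition dilate (R : realType) (n m : nat) (P : set 'rV[R]_n) :
    set 'rV[R]_n :=
  [set m%:R *: v | v in P].

Definition lattice_points (R : realType) (n : nat) (P : set 'rV[R]_n) :
    set 'rV[int]_n :=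
  [set z | P (map_mx intr z)].

(* [fset_set] sends infinite sets to the empty one; here [P] is meant to be
   bounded, so that the set of lattice points is finite. *)
Definition ehrhart (R : realType) (n : nat) (P : set 'rV[R]_n) (m : nat) : nat :=
  #|` fset_set (lattice_points (dilate m P)) |.

Definition affinely_independent (R : realType) (n k : nat)
    (v : 'I_k.+1 -> 'rV[R]_n) : bool :=
  row_free (\matrix_(i < k) (v (lift ord0 i) - v ord0)).

(* The largest k such that P contains k + 1 affinely independent points
   (and 0 when P is empty). *)
Definition polytope_dim (R : realType) (n : nat) (P : set 'rV[R]_n) : nat :=
  \max_(k < n.+1 | `[< exists v : 'I_k.+1 -> 'rV[R]_n,
                         (forall i, P (v i)) /\ affinely_independent v >]) k.

(* A formal power series in Z[[t]] is the sequence of its coefficients. *)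
Definition fps : Type := nat -> int.

Definition fps_mul (a b : fps) : fps :=
  fun k => \sum_(i < k.+1) a i * b (k - i)%N.

Definition fps_of_poly (p : {poly int}) : fps := fun k => p`_k.

Definition ehrhart_series (R : realType) (n : nat) (P : set 'rV[R]_n) : fps :=
  fun m => (ehrhart P m)%:Z.

(* Ehr_P(t) = p(t) / (1 - t)^(d + 1) in Z[[t]], with the denominator, a unit,
   cleared; this determines p. *)
Definition is_hstar (R : realType) (n : nat) (P : set 'rV[R]_n)
    (p : {poly int}) : Prop :=
  fps_mul (ehrhart_series P) (fps_of_poly ((1 - 'X) ^+ (polytope_dim P).+1))
  =1 fps_of_poly p.

Definition alternating (n : nat) (s : 'S_n) : bool :=
  [forall i : 'I_n, forall j : 'I_n, (j == i.+1 :> nat) ==>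
     (if odd i then (s j < s i)%N else (s i < s j)%N)].

(* The pair (i, j) ranges over consecutive values, j = i + 1. *)
Definition swap (n : nat) (s : 'S_n) : nat :=
  #|[pred p : 'I_n * 'I_n | (p.2 == p.1.+1 :> nat) &&
       (((s^-1)%g p.1).+1 < (s^-1)%g p.2)%N]|.

(* Main.v *)
Require Import Defs.
From mathcomp Require Import all_boot all_order all_algebra all_fingroup.
From mathcomp Require Import finmap boolp classical_sets cardinality reals.
From mathcomp Require Import zify.
Set Implicit Arguments.
Unset Strict Implicit.
Unset Printing Implicit Defensive.
Import Order.TTheory GRing.Theory Num.Theory.

(** The theorem is Stanley's formula for the h*-polynomial of an order polytope,
    read with a well-chosen natural labelling of the zig-zag poset.

    Stanley's formula.  The m-th Ehrhart number of an order polytope counts the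
    order-preserving maps f from the poset to {0, ..., m}
    ([ehrhart_order_polytope]).  Fix an injective labelling w of the poset that
    increases along its relations.  Ordering the elements by the value of f, and
    by the label among elements of equal value, gives a linear extension s; this
    sorts the maps f into classes indexed by the linear extensions
    ([card_order_preserving]).  A map lies in the class of s exactly when it is
    weakly increasing along s and strictly increasing at each descent of s, that
    is, wherever the label drops ([compatibleP]).  Subtracting from f the number
    of descents already passed turns the class of s into the set of all weakly
    increasing sequences of length n with values in {0, ..., m - des s}, so it
    has 'C(n + m - des s, n) elements ([card_compatible]).  The generating
    function of these binomials is t^(des s) / (1 - t)^(n + 1)
    ([fps_mul_binomial]).  As an order polytope of a poset on n elements is
    full-dimensional ([polytope_dim_order_polytope]), its h*-polynomial is the
    sum of t^(des s) over the linear extensions s ([order_polytope_hstar]).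

    The zig-zag poset.  Its linear extensions are the alternating permutations
    ([alternatingE]).  Cut z_1, ..., z_n into the blocks {z_1, z_2},
    {z_3, z_4}, ... and list the blocks from the last to the first, each of them
    in increasing order: ..., z_5, z_6, z_3, z_4, z_1, z_2.  This list is itself
    a linear extension, so it gives a natural labelling.  When z_a and z_b are
    consecutive in a linear extension, the label drops from z_a to z_b exactly
    when the block of z_b comes after that of z_a, since within a block the
    smaller index always comes first.  That means a + 1 < b: the only other
    possibility is b = a + 1 with z_a the last of its block, and then z_b lies
    below z_a, so that it cannot follow it.  Hence descents for this labelling
    are swaps ([swapE]). *)

(** * Permutations and strict total orders *)

Lemma perm_step_ind n (s : 'S_n) (r : rel 'I_n) :
    transitive r -> (forall x y, s y = (s x).+1 :> nat -> r x y) ->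
  forall x y, (s x < s y)%N -> r x y.
Proof.
move=> r_tr r_step x y; move: {2}(nat_of_ord (s y)) (erefl (nat_of_ord (s y))) => k.
elim: k y => [|k IHk] y.
  by move=> ->.
move=> sy; rewrite sy ltnS leq_eqVlt => /orP[/eqP sx|lt_xk].
  by apply: r_step; rewrite sy sx.
have lt_kn : (k < n)%N by apply: ltnW; rewrite -sy.
pose z := (s^-1)%g (Ordinal lt_kn).
have sz : s z = k :> nat by rewrite permKV.
apply: (r_tr z); first by apply: IHk; rewrite ?sz.
by apply: r_step; rewrite sy sz.
Qed.

(** Counting the smaller values recovers a value, so a permutation is
    determined by the order that it induces ([perm_eq_of_ltn]). *)
Lemma perm_val_card n (s : 'S_n) x :
  nat_of_ord (s x) = #|[pred y | (s y < s x)%N]|.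
Proof.
rewrite -sum1_card (reindex_inj (@perm_inj _ s^-1%g)) /=.
under eq_bigl => y do rewrite !inE permKV.
by rewrite big_ord_narrow ?sum1_card ?card_ord // ltnW.
Qed.

Lemma perm_eq_of_ltn n (s t : 'S_n) :
  (forall x y, (s x < s y)%N = (t x < t y)%N) -> s = t.
Proof.
move=> st; apply/permP=> x; apply: val_inj => /=.
rewrite (perm_val_card s) (perm_val_card t); apply: eq_card => y.
by rewrite !inE st.
Qed.

(** The permutation sends an element to its rank, the number of smaller ones. *)
Lemma strict_total_perm n (r : rel 'I_n) :
    irreflexive r -> transitive r -> (forall x y, x != y -> r x y || r y x) ->
  {s : 'S_n | forall x y, (s x < s y)%N = r x y}.
Proof.
move=> r_irr r_tr r_tot.
pose rk x := #|[pred y | r y x]|.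
have rk_lt x y : r x y -> (rk x < rk y)%N.
  move=> rxy; apply: proper_card; apply/properP; split.
    by apply/fintype.subsetP => z; rewrite !inE => /r_tr; apply.
  by exists x; rewrite !inE ?r_irr.
have rk_bound x : (rk x < n)%N.
  rewrite -[X in (_ < X)%N]card_ord; apply: proper_card; apply/properP.
  by split; [apply/fintype.subsetP | exists x; rewrite !inE ?r_irr].
have rk_inj : injective (fun x => Ordinal (rk_bound x)).
  move=> x y [] eq_rk; apply/eqP/idPn=> /r_tot /orP[] /rk_lt;
  by rewrite eq_rk ltnn.
exists (perm rk_inj) => x y; rewrite !permE /=.
apply/idP/idP=> [lt_rk|/rk_lt //].
have [exy|/r_tot /orP[//|/rk_lt]] := eqVneq x y.
  by rewrite exy ltnn in lt_rk.
by rewrite ltnNge ltnW.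
Qed.

(** * Linear extensions and order-preserving maps *)

Definition linear_extension n (lt : rel 'I_n) (s : 'S_n) : bool :=
  [forall x, forall y, lt x y ==> (s x < s y)%N].

(** A permutation s is seen as a listing of 'I_n in which x has position s x;
    a descent is a pair of elements in consecutive positions. *)
Definition descents n (w : 'I_n -> nat) (s : 'S_n) : pred ('I_n * 'I_n) :=
  [pred p | (s p.2 == (s p.1).+1 :> nat) && (w p.2 < w p.1)%N].

Definition des n (w : 'I_n -> nat) (s : 'S_n) : nat := #|descents w s|.

Definition order_preserving n k (lt : rel 'I_n) (f : 'I_n -> 'I_k) : bool :=
  [forall x, forall y, lt x y ==> (f x <= f y)%N].

Definition lexlt n k (w : 'I_n -> nat) (f : 'I_n -> 'I_k) : rel 'I_n :=
  fun x y => (f x < f y)%N || (f x == f y :> nat) && (w x < w y)%N.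

(** Weakly increasing along s, strictly at the descents.  A bound on
    the increment expresses both requirements at once. *)
Definition compatible n k (w : 'I_n -> nat) (s : 'S_n)
    (f : 'I_n -> 'I_k) : bool :=
  [forall x, forall y,
    (s y == (s x).+1 :> nat) ==> (f x + (w y < w x)%N <= f y)%N].

Lemma lexlt_perm n k (w : 'I_n -> nat) (f : 'I_n -> 'I_k) : injective w ->
  {s : 'S_n | forall x y, (s x < s y)%N = lexlt w f x y}.
Proof.
move=> w_inj; apply: strict_total_perm => [x|y x z|x y neq_xy]; rewrite /lexlt.
- by rewrite !ltnn andbF.
- lia.
- by have : w x != w y by [rewrite inj_eq]; lia.
Qed.

(** In one direction, the condition on consecutive positions propagates to all
    of them by transitivity of the lexicographic order, and a total order that
    refines another strict total order is equal to it. *)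
Lemma compatibleP n k (w : 'I_n -> nat) (f : 'I_n -> 'I_k) (s : 'S_n) :
    injective w ->
  reflect (forall x y, (s x < s y)%N = lexlt w f x y) (compatible w s f).
Proof.
move=> w_inj; apply: (iffP idP) => [/'forall_forallP cpt|lexE].
  have s_lex x y : (s x < s y)%N -> lexlt w f x y.
    move: x y; apply: perm_step_ind => [y x z|x y syx]; rewrite /lexlt; first lia.
    have /implyP := cpt x y; rewrite syx eqxx => /(_ isT).
    have : w x != w y.
      by rewrite inj_eq //; apply/eqP=> exy; move: syx; rewrite exy; lia.
    lia.
  move=> x y; apply/idP/idP=> [/s_lex //|lexxy].
  rewrite ltnNge leq_eqVlt; apply/negP=> /orP[/eqP/val_inj/perm_inj exy|/s_lex];
  by move: lexxy; rewrite /lexlt ?exy; lia.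
apply/'forall_forallP=> x y; apply/implyP=> /eqP syx.
by have := lexE x y; rewrite /lexlt; lia.
Qed.

Lemma compatible_lexlt_perm n k (w : 'I_n -> nat) (f : 'I_n -> 'I_k)
    (w_inj : injective w)    (s : 'S_n) :
  compatible w s f = (sval (lexlt_perm f w_inj) == s).
Proof.
case: lexlt_perm => t /= tE; apply/(compatibleP _ _ w_inj)/eqP => [sE|<- //].
by apply: perm_eq_of_ltn => x y; rewrite sE tE.
Qed.

(** Every order-preserving map is compatible with exactly one permutation, the
    one sorting by value and then by label.  Naturality of the labelling is what
    makes this permutation a linear extension: it settles the ties between
    related elements the right way.  Conversely, a map that is compatible with
    a linear extension preserves the order. *)
Lemma card_order_preserving n (lt : rel 'I_n) (w : 'I_n -> nat) m :
    injective w -> (forall x y, lt x y -> (w x < w y)%N) ->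
  #|[pred f : {ffun 'I_n -> 'I_m.+1} | order_preserving lt f]| =
  (\sum_(s | linear_extension lt s)
     #|[pred f : {ffun 'I_n -> 'I_m.+1} | compatible w s f]|)%N.
Proof.
move=> w_inj w_nat; rewrite -sum1_card.
pose std (f : {ffun 'I_n -> 'I_m.+1}) := sval (lexlt_perm f w_inj).
rewrite (partition_big std (linear_extension lt)) => /= [|f]; last first.
  rewrite inE /std; case: lexlt_perm => s /= sE /'forall_forallP fop.
  apply/'forall_forallP=> x y; apply/implyP=> ltxy; rewrite sE /lexlt.
  by have /implyP/(_ ltxy) := fop x y; have := w_nat x y ltxy; lia.
apply: eq_bigr => s /'forall_forallP s_lin; rewrite sum1_card.
apply: eq_card => f; rewrite !inE compatible_lexlt_perm unfold_in andbC.
apply: andb_idr => std_f; rewrite -compatible_lexlt_perm in std_f.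
move/(compatibleP _ _ w_inj): std_f => sE.
apply/'forall_forallP=> x y; apply/implyP=> ltxy.
by have /implyP/(_ ltxy) := s_lin x y; rewrite sE /lexlt; lia.
Qed.

(** * Counting the maps compatible with a linear extension *)

Definition descents_upto n (w : 'I_n -> nat) (s : 'S_n) (k : nat) : nat :=
  #|[pred p in descents w s | s p.2 <= k]|.

Lemma descents_upto0 n (w : 'I_n -> nat) (s : 'S_n) : descents_upto w s 0 = 0%N.
Proof.
apply: eq_card0 => p; rewrite !inE leqn0.
by apply/negP=> /andP[/andP[/eqP-> _]].
Qed.

Lemma descents_upto_last n (w : 'I_n -> nat) (s : 'S_n) :
  descents_upto w s n.-1 = des w s.
Proof.
apply: eq_card => -[x y]; rewrite !inE /= andb_idr // => _.
by have := ltn_ord (s y); lia.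
Qed.

Lemma descents_upto_homo n (w : 'I_n -> nat) (s : 'S_n) :
  {homo descents_upto w s : i j / (i <= j)%N}.
Proof.
move=> i j le_ij; apply/subset_leq_card/fintype.subsetP => p; rewrite !inE.
by case/andP=> -> /leq_trans->.
Qed.

Lemma descents_upto_step n (w : 'I_n -> nat) (s : 'S_n) x y :
    s y = (s x).+1 :> nat ->
  descents_upto w s (s y) = (descents_upto w s (s x) + (w y < w x))%N.
Proof.
move=> syx; rewrite addnC /descents_upto (cardD1 (x, y)) !inE /=.
rewrite syx eqxx leqnn andbT.
congr (_ + _)%N; apply: eq_card => -[x' y']; rewrite !inE /= xpair_eqE.
have [sx'|neq_s] := eqVneq (s y' : nat) (s x').+1; last by rewrite !andbF.
rewrite [(s y' <= _.+1)%N]leq_eqVlt ltnS.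
case: (eqVneq (s y' : nat) (s x).+1) => [sy'|_] /=.
  rewrite sy' ltnn andbF; move: (sx'); rewrite sy' => -[/val_inj/perm_inj ->].
  by rewrite -syx in sy'; rewrite (perm_inj (val_inj sy')) !eqxx.
have [->|_] := eqVneq y' y; last by rewrite andbF.
by rewrite syx ltnn !andbF.
Qed.

(** The increments required between consecutive positions add up: between any
    two positions, f must grow by at least the number of descents between them. *)
Lemma compatible_gapP n k (w : 'I_n -> nat) (s : 'S_n) (f : 'I_n -> 'I_k) :
  reflect (forall x y, (s x <= s y)%N ->
             (f x + descents_upto w s (s y) <= f y + descents_upto w s (s x))%N)
          (compatible w s f).
Proof.
apply: (iffP idP) => [/'forall_forallP cpt x y|gap].
  rewrite leq_eqVlt => /orP[/eqP/val_inj/perm_inj-> //|]; move: x y.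
  apply: perm_step_ind => [y x z|x y syx]; first lia.
  rewrite (descents_upto_step _ syx).
  by have /implyP := cpt x y; rewrite syx eqxx => /(_ isT); lia.
apply/'forall_forallP=> x y; apply/implyP=> /eqP syx.
by have := gap x y; rewrite (descents_upto_step _ syx); lia.
Qed.

(** Comparison with the elements in the first and in the last position. *)
Lemma compatible_bounds n m (w : 'I_n -> nat) (s : 'S_n)
    (f : 'I_n -> 'I_m.+1) x :
    compatible w s f ->
  (descents_upto w s (s x) <= f x)%N /\
  (f x + des w s <= m + descents_upto w s (s x))%N.
Proof.
move=> /compatible_gapP gap.
have n_gt0 : (0 < n)%N by have := ltn_ord x; lia.
have lt_n1 : (n.-1 < n)%N by rewrite prednK.
pose x0 := (s^-1)%g (Ordinal n_gt0); pose x1 := (s^-1)%g (Ordinal lt_n1).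
have := gap x0 x; have := gap x x1; rewrite !permKV /= descents_upto0.
rewrite descents_upto_last => gap1 gap0.
have := ltn_ord (f x1); have := ltn_ord (s x); split; first by have := gap0 isT; lia.
by have := gap1 ltac:(lia); lia.
Qed.

(** Let c i be the number of descents up to position i.  The compatible maps are
    the maps x |-> t_(s x) + c (s x), for t a weakly increasing sequence with
    values at most m - des s. *)
Lemma card_compatible n m (w : 'I_n -> nat) (s : 'S_n) :
  #|[pred f : {ffun 'I_n -> 'I_m.+1} | compatible w s f]| =
  if (des w s <= m)%N then 'C(n + (m - des w s), n) else 0%N.
Proof.
pose c := descents_upto w s; case: leqP => [le_dm|lt_md]; last first.
  (* The element in the last position would have value at least des s > m. *)
  apply: eq_card0 => f; rewrite !inE; apply/negP=> /compatible_bounds bnd.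
  have n_gt0 : (0 < n)%N.
    rewrite lt0n; apply/eqP=> n0; move: lt_md.
    by rewrite /des eq_card0 // => -[x y]; have := ltn_ord x; lia.
  have lt_n1 : (n.-1 < n)%N by rewrite prednK.
  have := bnd ((s^-1)%g (Ordinal lt_n1)); rewrite permKV /c /= descents_upto_last.
  by set x := f _; have := ltn_ord x; lia.
set d := (m - _)%N.
have c_le k : (k < n)%N -> (c k <= des w s)%N.
  by move=> ltkn; rewrite -(descents_upto_last w s); apply: descents_upto_homo; lia.
rewrite -card_sorted_tuples.
pose Phi (t : n.-tuple 'I_d.+1) : {ffun 'I_n -> 'I_m.+1} :=
  [ffun x => inord (tnth t (s x) + c (s x))].
have PhiE t x : Phi t x = (tnth t (s x) + c (s x))%N :> nat.
  rewrite ffunE inordK //; have := ltn_ord (tnth t (s x)).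
  by have := c_le _ (ltn_ord (s x)); rewrite /d; lia.
have Phi_inj : injective Phi.
  move=> t t' /ffunP eqPhi; apply: eq_from_tnth => i; apply: val_inj => /=.
  have := congr1 val (eqPhi ((s^-1)%g i)); rewrite /= !PhiE permKV.
  exact: addIn.
have sortedE (t : n.-tuple 'I_d.+1) :
    reflect (forall i j : 'I_n, (i <= j)%N -> (tnth t i <= tnth t j)%N)
            (sorted leq (map val t)).
  pose x0 := @ord0 d.
  apply: (iffP idP) => [srt i j le_ij|homo_t].
    have := sorted_leq_nth leq_trans leqnn 0%N srt; rewrite /prop_in2.
    move=> /(_ i j); rewrite !inE size_map size_tuple.
    move=> /(_ (ltn_ord i) (ltn_ord j) le_ij).
    by rewrite !(nth_map x0) ?size_tuple // -!tnth_nth.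
  apply/(sortedP 0%N) => i; rewrite size_map size_tuple => lt_i1n.
  rewrite !(nth_map x0) ?size_tuple ?(ltnW lt_i1n) //.
  have := homo_t (Ordinal (ltnW lt_i1n)) (Ordinal lt_i1n) (leqnSn i).
  by rewrite !(tnth_nth x0).
rewrite -(card_imset _ Phi_inj); apply: eq_card => /= f; rewrite !inE.
apply/idP/imsetP => [cpt|[t + ->]].
  exists [tuple inord (f ((s^-1)%g i) - c i) | i < n].
    rewrite inE; apply/sortedE => i j le_ij; rewrite !tnth_mktuple.
    have [ci_le fi_le] := compatible_bounds ((s^-1)%g i) cpt.
    have [cj_le fj_le] := compatible_bounds ((s^-1)%g j) cpt.
    have /compatible_gapP/(_ ((s^-1)%g i) ((s^-1)%g j)) := cpt.
    rewrite !permKV -/c in ci_le fi_le cj_le fj_le *.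
    by move=> /(_ le_ij); rewrite !inordK /d; lia.
  apply/ffunP=> /= x; apply: val_inj; rewrite /= PhiE tnth_mktuple permK.
  have [cx_le fx_le] := compatible_bounds x cpt.
  by rewrite -/c in cx_le fx_le; rewrite inordK /d; lia.
rewrite inE => /sortedE homo_t; apply/compatible_gapP => x y /homo_t.
by rewrite !PhiE -/c; lia.
Qed.

Local Open Scope ring_scope.

(** * Power series *)

(** The first coefficients of a product with a power series are those of the
    product with a truncation of it, which reduces them to polynomials. *)
Lemma fps_mul_coefM (a : fps) (p : {poly int}) N k : (k < N)%N ->
  fps_mul a (fps_of_poly p) k = ((\poly_(i < N) a i) * p)`_k.
Proof.
move=> lt_kN; rewrite coefM; apply: eq_bigr => i _; rewrite coef_poly.
by rewrite (leq_ltn_trans _ lt_kN) // -ltnS.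
Qed.

Lemma eq_fps_mul (a a' b : fps) : a =1 a' -> fps_mul a b =1 fps_mul a' b.
Proof. by move=> eq_a k; apply: eq_bigr => i _; rewrite eq_a. Qed.

Lemma fps_mul_sum I (r : seq I) (P : pred I) (a : I -> fps) (b : fps) k :
  fps_mul (fun m => \sum_(i <- r | P i) a i m) b k
  = \sum_(i <- r | P i) fps_mul (a i) b k.
Proof.
rewrite exchange_big /=; apply: eq_bigr => j _; by rewrite mulr_suml.
Qed.

Definition fps_diff (a : fps) : fps :=
  fun k => a k - (if k is k'.+1 then a k' else 0).

Lemma fps_mul_1subX (a : fps) (p : {poly int}) :
  fps_mul a (fps_of_poly ((1 - 'X) * p)) =1 fps_mul (fps_diff a) (fps_of_poly p).
Proof.
move=> k; rewrite !(fps_mul_coefM _ _ (ltnSn k)) mulrA !coefM.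
apply: eq_bigr => -[i /= lt_ik] _; congr (_ * _).
rewrite mulrBr mulr1 coefB coefMX !coef_poly lt_ik /fps_diff.
by case: i lt_ik => //= i /ltnW->.
Qed.

(** By induction on n: multiplying by 1 - t replaces the coefficients by their
    differences, and Pascal's rule says that the difference of the n+1 case is
    the n case. *)
Lemma fps_mul_binomial d n :
  fps_mul (fun m => (if (d <= m)%N then 'C(n + (m - d), n) else 0%N)%:Z)
          (fps_of_poly ((1 - 'X) ^+ n.+1)) =1 fps_of_poly 'X^d.
Proof.
elim: n => [|n IHn] k.
  rewrite expr1 -[1 - 'X]mulr1 fps_mul_1subX (fps_mul_coefM _ _ (ltnSn k)).
  rewrite mulr1 coef_poly ltnSn /fps_of_poly coefXn /fps_diff.
  case: k => [|k]; rewrite !bin0; first by case: d.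
  case: (ltngtP d k.+1) => [|lt_kd|->]; first by rewrite ltnS => ->.
    by rewrite leqNgt (ltnW lt_kd).
  by rewrite ltnn.
rewrite exprS fps_mul_1subX -IHn; apply: eq_fps_mul => {}k.
rewrite /fps_diff; case: k => [|k].
  by case: d {IHn} => [|d] //=; rewrite subr0 !addn0 !binn.
case: (ltngtP d k.+1) => [lt_dk|lt_kd|->].
- rewrite -ltnS lt_dk subSn // -[(n + _)%N]addSnnS addnS binS PoszD.
  by rewrite addrC addKr.
- by rewrite leqNgt (ltnW lt_kd).
- by rewrite ltnn subnn !addn0 !binn.
Qed.

(** * Order polytopes *)

Section OrderPolytope.
Variables (R : realType) (n : nat) (lt : rel 'I_n).

(** The point f / m of the polytope witnesses an order-preserving map f.  This
    is also correct for m = 0, as then f and its quotient by 0 are both zero. *)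
Lemma lattice_points_dilate m :
  lattice_points (dilate m (order_polytope R lt)) =
  [set` [fset \row_i (f i : nat)%:Z |
         f : {ffun 'I_n -> 'I_m.+1} in
         [pred f | order_preserving lt (f : {ffun _})]]%fset]%classic.
Proof.
apply/seteqP; split=> [z [v [v01 v_homo] /rowP mvz]|_ /imfsetP[f f_homo ->]].
  have zE i : (z 0 i)%:~R = m%:R * v 0 i by have := mvz i; rewrite !mxE.
  have z_ge0 i : (0 <= z 0 i)%R.
    by rewrite -(ler0z R) zE mulr_ge0 // ?ler0n //; case/andP: (v01 i).
  have z_lem i : (absz (z 0%R i) < m.+1)%N.
    rewrite ltnS -lez_nat gez0_abs // -(ler_int R) zE.
    by rewrite ler_piMr ?ler0n //; case/andP: (v01 i).
  apply/imfsetP; exists [ffun i => Ordinal (z_lem i)].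
    apply/'forall_forallP=> i j; apply/implyP=> lt_ij.
    rewrite !ffunE /= -lez_nat !gez0_abs // -(ler_int R) !zE.
    by rewrite ler_wpM2l ?ler0n ?v_homo.
  by apply/rowP=> i; rewrite !mxE ffunE /= gez0_abs.
move/'forall_forallP: f_homo => f_homo.
have f_le i : (f i <= m)%N by rewrite -ltnS.
exists (\row_i ((f i : nat)%:R / m%:R)); last first.
  apply/rowP=> i; rewrite !mxE; have [m0|m_neq0] := eqVneq m 0%N.
    have /eqP-> : f i == 0%N :> nat by have := f_le i; lia.
    by rewrite m0 !mul0r.
  by rewrite mulrC divfK // pnatr_eq0.
split=> [i|i j lt_ij]; rewrite !mxE.
  rewrite divr_ge0 ?ler0n //=; have [m0|m_gt0] := posnP m.
    by rewrite [in X in _ / X]m0 invr0 mulr0 ler01.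
  by rewrite ler_pdivrMr ?ltr0n // mul1r ler_nat.
rewrite ler_wpM2r ?invr_ge0 ?ler0n // ler_nat.
by have /implyP/(_ lt_ij) := f_homo i j.
Qed.

Lemma ehrhart_order_polytope m :
  ehrhart (order_polytope R lt) m =
  #|[pred f : {ffun 'I_n -> 'I_m.+1} | order_preserving lt f]|.
Proof.
rewrite /ehrhart lattice_points_dilate set_fsetK card_imfset /=.
  by rewrite cardE; congr size; apply: eq_enum => f.
move=> f g /rowP eq_fg; apply/ffunP => i; apply: val_inj.
by have := eq_fg i; rewrite !mxE => -[].
Qed.

(** Distinct related elements have labels at distance at least one, so the
    scaled labels w / N, with N larger than all labels, remain in the polytope
    when any coordinate is increased by 1 / N.  These n + 1 points are affinely
    independent. *)
Lemma polytope_dim_order_polytope (w : 'I_n -> nat) :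
  (forall i j, lt i j -> (w i < w j)%N) ->
  polytope_dim (order_polytope R lt) = n.
Proof.
move=> w_nat; apply/eqP; rewrite eqn_leq; apply/andP; split.
  by apply/bigmax_leqP => k _; rewrite -ltnS.
rewrite -[X in (X <= _)%N]/(val (@ord_max n)).
apply: leq_bigmax_cond; apply/asboolP => /=.
pose N := (\max_i w i).+1.
have w_lt i : (w i < N)%N by rewrite ltnS (leq_bigmax i).
pose c : 'rV[R]_n := \row_i ((w i)%:R / N%:R).
pose e (k : 'I_n) : 'rV[R]_n := N%:R^-1 *: delta_mx 0 k.
exists (fun i => if unlift ord0 i is Some k then c + e k else c); split.
  have w_P (b : 'I_n -> bool) :
      order_polytope R lt (\row_i ((w i + b i)%:R / N%:R)).
    split=> [i|i j lt_ij]; rewrite !mxE.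
      rewrite divr_ge0 ?ler0n //= ler_pdivrMr ?ltr0n // mul1r ler_nat.
      by have := w_lt i; case: (b i); lia.
    rewrite ler_wpM2r ?invr_ge0 ?ler0n // ler_nat.
    by have := w_nat _ _ lt_ij; case: (b i); case: (b j); lia.
  move=> i; case: unliftP => [k _|_].
    rewrite (_ : c + e k = \row_i ((w i + (i == k))%:R / N%:R)) //.
    by apply/rowP=> j; rewrite !mxE eqxx /= natrD mulrDl [_^-1 * _]mulrC.
  rewrite (_ : c = \row_i ((w i + false)%:R / N%:R)) //.
  by apply/rowP=> j; rewrite !mxE addn0.
(* The difference vectors are the rows of the scalar matrix 1 / N. *)
rewrite /affinely_independent (_ : \matrix_k _ = N%:R^-1%:M).
  by rewrite row_free_unit unitmxE det_scalar unitrX // unitfE invr_eq0 pnatr_eq0.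
apply/matrixP=> k j; rewrite mxE unlift_none liftK [c + _]addrC addrK.
by rewrite !mxE eqxx /= eq_sym mulr_natr.
Qed.

(** Stanley's formula for a natural labelling w. *)
Theorem order_polytope_hstar (w : 'I_n -> nat) :
    injective w -> (forall i j, lt i j -> (w i < w j)%N) ->
  is_hstar (order_polytope R lt)
    (\sum_(s : 'S_n | linear_extension lt s) 'X^(des w s)).
Proof.
move=> w_inj w_nat; rewrite /is_hstar (polytope_dim_order_polytope w_nat) => k.
pose a (s : 'S_n) : fps :=
  fun m => (if (des w s <= m)%N then 'C(n + (m - des w s), n) else 0%N)%:Z.
rewrite (@eq_fps_mul _ (fun m => \sum_(s | linear_extension lt s) a s m)).
  rewrite fps_mul_sum /fps_of_poly coef_sum; apply: eq_bigr => s _.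
  exact: fps_mul_binomial.
move=> m; rewrite /ehrhart_series ehrhart_order_polytope.
rewrite (card_order_preserving m w_inj w_nat) -natz natr_sum.
by apply: eq_bigr => s _; rewrite natz /a -card_compatible.
Qed.

End OrderPolytope.

(** * The zig-zag poset *)

Lemma zigzag_ltE n (i j : 'I_n) : zigzag_lt i j = zigzag_cover i j.
Proof.
rewrite /zigzag_lt Order.POrderTheory.lt_neqAle.
rewrite [(_ <= _)%O]zigzag_leE; case: eqVneq => //= ->.
by apply/esym/negP=> /and3P[/negP].
Qed.

(** With indices from 0, the block of i is i./2.  The labels decrease from one
    block to the next and increase inside each block. *)
Definition zigzag_label n (i : 'I_n) : nat := ((n - i./2).*2 + odd i)%N.

Lemma zigzag_label_inj n : injective (@zigzag_label n).
Proof.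
move=> i j; rewrite /zigzag_label => eq_ij; apply: val_inj => /=.
by have := ltn_ord i; have := ltn_ord j; lia.
Qed.

Lemma zigzag_label_natural n (i j : 'I_n) :
  zigzag_lt i j -> (zigzag_label i < zigzag_label j)%N.
Proof.
rewrite zigzag_ltE /zigzag_cover /zigzag_label.
by have := ltn_ord i; have := ltn_ord j; lia.
Qed.

Lemma alternatingE n (s : 'S_n) :
  alternating s = linear_extension (@zigzag_lt n) s.
Proof.
apply/'forall_forallP/'forall_forallP => s_alt i j; apply/implyP.
  rewrite zigzag_ltE => /and3P[odd_i odd_j /orP[]] /eqP ij.
    by have /implyP := s_alt i j; rewrite ij eqxx (negPf odd_i); apply.
  by have /implyP := s_alt j i; rewrite ij eqxx odd_j; apply.
move=> /eqP ij; have := s_alt i j; have := s_alt j i.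
rewrite !zigzag_ltE /zigzag_cover ij /=.
by rewrite !eqxx !andbT orbT; case: (odd i).
Qed.

(** A swap (i, j) is a pair of consecutive positions, a descent a pair of
    elements; the inverse of s turns the first into the second.  That s
    alternates serves to exclude a descent (x, y) with y <= x.+1: the two
    elements would be neighbours in the poset, listed in the wrong order. *)
Lemma swapE n (s : 'S_n) :
  alternating s -> swap s = des (@zigzag_label n) s.
Proof.
move=> /'forall_forallP s_alt.
pose h (p : 'I_n * 'I_n) := ((s^-1)%g p.1, (s^-1)%g p.2).
have h_inj : injective h.
  by move=> [x y] [x' y'] [/perm_inj-> /perm_inj->].
rewrite /swap -[LHS](fintype.card_image h_inj); apply: eq_card => -[x y].
apply/fintype.imageP/andP => /= [[[i j]]|[syx desc]].
  rewrite !inE /= => /andP[/eqP ji swp] [-> ->]; rewrite !permKV ji eqxx.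
  split=> //; rewrite /zigzag_label; move: (_ i) (_ j) swp => x' y'.
  by have := ltn_ord y'; lia.
exists (s x, s y); last by rewrite /h /= !permK.
rewrite !inE /= !permK syx /=; rewrite ltnNge; apply/negP=> le_yx.
move: desc (s_alt x y) (s_alt y x); rewrite /zigzag_label (eqP syx).
have [odd_x|even_x] := boolP (odd x); have [odd_y|even_y] := boolP (odd y);
by have := ltn_ord x; have := ltn_ord y; lia.
Qed.

Theorem theorem1p9 (R : realType) (n : nat) (hn : (1 <= n)%N) :
  is_hstar (order_polytope R (@zigzag_lt n))
    (\sum_(s : 'S_n | alternating s) 'X^(swap s)).
Proof.
have := order_polytope_hstar R (@zigzag_label_inj n) (@zigzag_label_natural n).
congr (is_hstar _ _); rewrite -(eq_bigl _ _ (@alternatingE n)).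
by apply: eq_bigr => s /swapE->.
Qed.
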